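(* Consider the triangle of groups (Corson diagram based on $I=\{1,2,3\}$) given by $G_\emptyset=\{1\}$, $G_{\{1\}}=\langle a\,:\,-\rangle$, $G_{\{2\}}=\langle b\,:\,-\rangle$, $G_{\{3\}}=\langle c\,:\,-\rangle$ (infinite cyclic groups), $G_{\{1,2\}}=\langle a,b\,:\,b^{-1}ab=a^2\rangle$, $G_{\{1,3\}}=\langle a,c\,:\,c^{-1}ac=a^2\rangle$, $G_{\{2,3\}}=\langle b,c\,:\,bc=cb\rangle$, with the homomorphisms $\varphi_{J_1J_2}:G_{J_1}\to G_{J_2}$ given by $a\mapsto a$, $b\mapsto b$, $c\mapsto c$. Let $\mathcal{G}$ be its colimit group. Then the equation $\mathcal{G}|_{\{1,2\}}\cap\mathcal{G}|_{\{1,3\}}=\mathcal{G}|_{\{1\}}$ (of subgroups of $\mathcal{G}$) does not hold.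
   Context: A Corson diagram based on a set $I$ consists of a group $G_J$ for every $J\subseteq I$ with $|J|\le 2$ and an injective homomorphism $\varphi_{J_1J_2}:G_{J_1}\to G_{J_2}$ for every strict inclusion $J_1\subset J_2\subseteq I$ with $|J_2|\le 2$, such that $\varphi_{\emptyset J_3}=\varphi_{J_2J_3}\circ\varphi_{\emptyset J_2}$ whenever $\emptyset\subset J_2\subset J_3$ and $|J_3|=2$. (The data in the claim satisfy these conditions.) The colimit group $\mathcal{G}$ is the quotient of the free product of all the $G_J$ ($J\subseteq I$, $|J|\le 2$) by the relations $g=\varphi_{J_1J_2}(g)$ for all $J_1\subset J_2\subseteq I$ with $|J_2|\le 2$ and all $g\in G_{J_1}$. For $K\subseteq I$, $\mathcal{G}|_K$ denotes the subgroup of $\mathcal{G}$ generated by the images of the groups $G_J$ with $J\subseteq K$ and $|J|\le 2$. (In this example the colimit group of the subdiagram spanned by the $G_J$ with $J\subseteq K$, $|J|\le 2$, maps injectively onto this subgroup.) *)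

(* Defs.v *)
From HB Require Import structures.
From Stdlib Require Import Relation_Operators.
From mathcomp Require Import all_boot all_order all_algebra.
From mathcomp Require Import finmap all_classical.

Set Implicit Arguments.
Unset Strict Implicit.
Unset Printing Implicit Defensive.

Local Open Scope quotient_scope.
Local Open Scope group_scope.

Notation group_hom G H := (UMagmaMorphism.type G H).

Section Subgroups.
Variable G : groupType.

Definition subgroup (H : set G) : Prop :=
  [/\ H 1, forall x y, H x -> H y -> H (x * y) & forall x, H x -> H x^-1].

Definition normal_subgroup (N : set G) : Prop :=
  subgroup N /\ forall x g, N x -> N (x ^ g).

Definition generated (S : set G) : set G := smallest subgroup S.

Definition normal_closure (S : set G) : set G := smallest normal_subgroup S.

Lemma normal_closureP S : normal_subgroup (normal_closure S).
Proof.
split; first split.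
- by move=> N [[[]]].
- by move=> x y Nx Ny N NP; case: (NP) => [[[_ NM _] _] _]; apply: NM; [apply: Nx|apply: Ny].
- by move=> x Nx N NP; case: (NP) => [[[_ _ NV] _] _]; apply: NV; apply: Nx.
- by move=> x g Nx N NP; case: (NP) => [[_ NJ] _]; apply: NJ; apply: Nx.
Qed.

End Subgroups.

(* Words in the letters x, x^-1, encoded as (x, true), (x, false), modulo
   insertion and deletion of x x^-1 and x^-1 x. *)
Section FreeGroup.
Variable X : choiceType.
Implicit Types (s t u v : seq (X * bool)) (l : X * bool).

Definition linv l : X * bool := (l.1, ~~ l.2).

Variant cancel1 : seq (X * bool) -> seq (X * bool) -> Prop :=
  Cancel1 s t l : cancel1 (s ++ l :: linv l :: t) (s ++ t).

Definition weq s t : bool := `[< clos_refl_sym_trans _ cancel1 s t >].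

Lemma weq_refl : reflexive weq.
Proof. by move=> s; apply/asboolP; apply: rst_refl. Qed.

Lemma weq_sym : symmetric weq.
Proof. by move=> s t; apply/asboolP/asboolP => st; apply: rst_sym. Qed.

Lemma weq_trans : transitive weq.
Proof.
by move=> t s u /asboolP st /asboolP tu; apply/asboolP; apply: rst_trans st tu.
Qed.

Canonical weq_equiv := EquivRel weq weq_refl weq_sym weq_trans.

Definition free_group := {eq_quot weq}.
HB.instance Definition _ := Choice.on free_group.

Lemma weq_ind2 (P : seq (X * bool) -> seq (X * bool) -> Prop) :
  (forall s, P s s) -> (forall s t, P s t -> P t s) ->
  (forall t s u, P s t -> P t u -> P s u) ->
  (forall s t l, P (s ++ l :: linv l :: t) (s ++ t)) ->
  forall s t, weq s t -> P s t.
Proof.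
move=> Pr Ps Pt P1 s t /asboolP; elim=> {s t}; auto.
- by move=> _ _ [].
- by move=> s t u _ + _; apply: Pt.
Qed.

Lemma weq_cancel s t l : weq (s ++ l :: linv l :: t) (s ++ t).
Proof. by apply/asboolP; apply: rst_step. Qed.

Lemma weq_cat s t u v : weq s t -> weq u v -> weq (s ++ u) (t ++ v).
Proof.
move=> st uv; apply: (@weq_trans (t ++ u)).
- move: st; apply: (weq_ind2 (P := fun s t => weq (s ++ u) (t ++ u))).
  + by move=> ?; apply: weq_refl.
  + by move=> ? ?; rewrite weq_sym.
  + by move=> ? ? ?; apply: weq_trans.
  + by move=> a b l; rewrite -!catA; apply: weq_cancel.
- move: uv; apply: (weq_ind2 (P := fun u v => weq (t ++ u) (t ++ v))).
  + by move=> ?; apply: weq_refl.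
  + by move=> ? ?; rewrite weq_sym.
  + by move=> ? ? ?; apply: weq_trans.
  + by move=> a b l; rewrite !catA; apply: weq_cancel.
Qed.

Definition winv s := rev (map linv s).

Lemma linvK : involutive linv.
Proof. by case=> x b; rewrite /linv /= negbK. Qed.

Lemma winv_cat s t : winv (s ++ t) = winv t ++ winv s.
Proof. by rewrite /winv map_cat rev_cat. Qed.

Lemma winvK : involutive winv.
Proof. by move=> s; rewrite /winv map_rev revK mapK //; apply: linvK. Qed.

Lemma weq_mulV s : weq (s ++ winv s) [::].
Proof.
elim/last_ind: s => [|s l IHs]; first exact: weq_refl.
apply: weq_trans IHs; rewrite -cats1 winv_cat -!catA /=.
exact: weq_cancel.
Qed.

Lemma weq_Vmul s : weq (winv s ++ s) [::].
Proof. by rewrite -{2}(winvK s) weq_mulV. Qed.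

Lemma weq_inv s t : weq s t -> weq (winv s) (winv t).
Proof.
move=> st; apply: (@weq_trans (winv s ++ (t ++ winv t))).
  by rewrite -{1}[winv s]cats0 weq_cat ?weq_refl // weq_sym weq_mulV.
apply: (@weq_trans (winv s ++ (s ++ winv t))).
  by rewrite !weq_cat ?weq_refl // weq_sym.
by rewrite catA -{2}[winv t]cat0s weq_cat ?weq_refl // weq_Vmul.
Qed.

Definition free_one : free_group := \pi_free_group [::].
Definition free_mul (x y : free_group) : free_group := \pi_free_group (repr x ++ repr y).
Definition free_inv (x : free_group) : free_group := \pi_free_group (winv (repr x)).

Lemma free_eqP s t : reflect (\pi_free_group s = \pi_free_group t) (weq s t).
Proof. exact: (@eqmodP _ weq_equiv). Qed.

Lemma weq_repr s : weq (repr (\pi_free_group s)) s.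
Proof. by apply/free_eqP; rewrite reprK. Qed.

Lemma free_mulE s t : free_mul (\pi s) (\pi t) = \pi_free_group (s ++ t).
Proof. by apply/free_eqP; rewrite weq_cat ?weq_repr. Qed.

Lemma free_invE s : free_inv (\pi s) = \pi_free_group (winv s).
Proof. by apply/free_eqP; rewrite weq_inv ?weq_repr. Qed.

Lemma free_mulA : associative free_mul.
Proof.
by move=> x y z; rewrite -[x]reprK -[y]reprK -[z]reprK !free_mulE catA.
Qed.

Lemma free_mul1 : left_id free_one free_mul.
Proof. by move=> x; rewrite -[x]reprK free_mulE. Qed.

Lemma free_1mul : right_id free_one free_mul.
Proof. by move=> x; rewrite -[x]reprK free_mulE cats0. Qed.

Lemma free_mulV : left_inverse free_one free_inv free_mul.
Proof.
by move=> x; rewrite -[x]reprK free_invE free_mulE; apply/free_eqP/weq_Vmul.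
Qed.

Lemma free_Vmul : right_inverse free_one free_inv free_mul.
Proof.
by move=> x; rewrite -[x]reprK free_invE free_mulE; apply/free_eqP/weq_mulV.
Qed.

HB.instance Definition _ :=
  isGroup.Build free_group free_mulA free_mul1 free_1mul free_mulV free_Vmul.

Definition gen (x : X) : free_group := \pi_free_group [:: (x, true)].

Lemma free_piM s t : (\pi_free_group s : free_group) * \pi_free_group t = \pi_free_group (s ++ t).
Proof. exact: free_mulE. Qed.

Lemma free_piV s : (\pi_free_group s : free_group)^-1 = \pi_free_group (winv s).
Proof. exact: free_invE. Qed.

Lemma free_ind (P : free_group -> Prop) :
  P 1 -> (forall x g, P g -> P (gen x * g)) ->
  (forall x g, P g -> P ((gen x)^-1 * g)) -> forall g, P g.
Proof.
move=> P1 Pg PV g; rewrite -[g]reprK; elim: (repr g) => [//|[x b] s IHs].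
case: b.
- by have := Pg x _ IHs; rewrite free_piM.
- by have := PV x _ IHs; rewrite free_piV free_piM.
Qed.

Section Lift.
Variables (H : groupType) (f : X -> H).

Definition weval s : H := \prod_(l <- s) (if l.2 then f l.1 else (f l.1)^-1).

Definition free_lift (x : free_group) : H := weval (repr x).

Lemma weval_cat s t : weval (s ++ t) = weval s * weval t.
Proof. by rewrite /weval big_cat. Qed.

Lemma weval_weq s t : weq s t -> weval s = weval t.
Proof.
apply: (weq_ind2 (P := fun s t => weval s = weval t)) => //.
- by move=> ? ? ? -> ->.
- move=> a b [x e]; rewrite !weval_cat /weval !big_cons /=.
  by case: e => /=; rewrite ?mulVKg ?mulKg.
Qed.

Lemma free_liftE s : free_lift (\pi_free_group s) = weval s.
Proof. exact/weval_weq/weq_repr. Qed.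

Lemma free_lift_morph : monoid_morphism free_lift.
Proof.
split; first by rewrite [LHS]free_liftE /weval big_nil.
move=> x y; rewrite -[x]reprK -[y]reprK free_piM !free_liftE.
exact: weval_cat.
Qed.

HB.instance Definition _ := isUMagmaMorphism.Build free_group H free_lift free_lift_morph.

Lemma free_lift_gen x : free_lift (gen x) = f x.
Proof. by rewrite free_liftE /weval big_seq1. Qed.

End Lift.
End FreeGroup.

Arguments gen : simpl never.
Arguments free_lift : simpl never.

(* The quotient of H by the relations u = v, for all u, v such that R u v:
   the cosets of the normal closure of the elements u^-1 v. *)
Section Quotient.
Variables (H : groupType) (R : H -> H -> Prop).

Definition relator : set H := [set w | exists u v, R u v /\ w = u^-1 * v].

Definition qeq (x y : H) : bool := `[< normal_closure relator (x^-1 * y) >].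

Let N1 : normal_closure relator 1.
Proof. by have [[]] := normal_closureP relator. Qed.

Let NM x y : normal_closure relator x -> normal_closure relator y ->
  normal_closure relator (x * y).
Proof. by have [[_ + _] _] := normal_closureP relator; apply. Qed.

Let NV x : normal_closure relator x -> normal_closure relator x^-1.
Proof. by have [[_ _ +] _] := normal_closureP relator; apply. Qed.

Let NJ x g : normal_closure relator x -> normal_closure relator (x ^ g).
Proof. by have [_ +] := normal_closureP relator; apply. Qed.

Lemma qeq_refl : reflexive qeq.
Proof. by move=> x; apply/asboolP; rewrite mulVg. Qed.

Lemma qeq_sym : symmetric qeq.
Proof. by move=> x y; apply/asboolP/asboolP => /NV; rewrite invgM invgK. Qed.

Lemma qeq_trans : transitive qeq.
Proof.
move=> y x z /asboolP xy /asboolP yz; apply/asboolP.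
by have := NM xy yz; rewrite mulgA mulgK.
Qed.

Canonical qeq_equiv := EquivRel qeq qeq_refl qeq_sym qeq_trans.

Definition quotient_by := {eq_quot qeq}.
HB.instance Definition _ := Choice.on quotient_by.

Local Notation Q := quotient_by.

Definition quo_pi (x : H) : Q := \pi_Q x.

Definition quo_one : Q := quo_pi 1.
Definition quo_mul (x y : Q) : Q := quo_pi (repr x * repr y).
Definition quo_inv (x : Q) : Q := quo_pi (repr x)^-1.

Lemma quo_eqP x y : reflect (quo_pi x = quo_pi y) (qeq x y).
Proof. exact: (@eqmodP _ qeq_equiv). Qed.

Lemma qeq_repr x : qeq (repr (quo_pi x)) x.
Proof. by apply/quo_eqP; rewrite /quo_pi reprK. Qed.

Lemma quo_mulE x y : quo_mul (quo_pi x) (quo_pi y) = quo_pi (x * y).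
Proof.
apply/quo_eqP/asboolP; rewrite invgM.
have /asboolP xP := qeq_repr x; have /asboolP yP := qeq_repr y.
have := NM (NJ (repr (quo_pi y)) xP) yP.
by rewrite /conjg !mulgA mulgK.
Qed.

Lemma quo_invE x : quo_inv (quo_pi x) = quo_pi x^-1.
Proof.
apply/quo_eqP/asboolP; rewrite invgK.
have := qeq_repr x; rewrite qeq_sym => /asboolP.
by move/(NJ x^-1); rewrite /conjg invgK mulgA mulVKg.
Qed.

Lemma quo_reprK (x : Q) : quo_pi (repr x) = x.
Proof. exact: reprK. Qed.

Lemma quo_mulA : associative quo_mul.
Proof.
by move=> x y z; rewrite -[x]quo_reprK -[y]quo_reprK -[z]quo_reprK !quo_mulE mulgA.
Qed.

Lemma quo_mul1 : left_id quo_one quo_mul.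
Proof. by move=> x; rewrite -[x]quo_reprK quo_mulE mul1g. Qed.

Lemma quo_1mul : right_id quo_one quo_mul.
Proof. by move=> x; rewrite -[x]quo_reprK quo_mulE mulg1. Qed.

Lemma quo_mulV : left_inverse quo_one quo_inv quo_mul.
Proof. by move=> x; rewrite -[x]quo_reprK quo_invE quo_mulE mulVg. Qed.

Lemma quo_Vmul : right_inverse quo_one quo_inv quo_mul.
Proof. by move=> x; rewrite -[x]quo_reprK quo_invE quo_mulE mulgV. Qed.

HB.instance Definition _ :=
  isGroup.Build quotient_by quo_mulA quo_mul1 quo_1mul quo_mulV quo_Vmul.

Lemma quo_pi_morph : monoid_morphism quo_pi.
Proof. by split=> [//|x y]; rewrite -quo_mulE. Qed.

HB.instance Definition _ := isUMagmaMorphism.Build H quotient_by quo_pi quo_pi_morph.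

Lemma quo_rel u v : R u v -> quo_pi u = quo_pi v.
Proof.
by move=> Ruv; apply/quo_eqP/asboolP; apply: sub_gen_smallest; exists u, v.
Qed.

Section Lift.
Variables (K : groupType) (f : group_hom H K).
Hypothesis fR : forall u v, R u v -> f u = f v.

Definition quo_lift of (forall u v, R u v -> f u = f v) :=
  fun x : quotient_by => f (repr x).

Lemma quo_liftE x : quo_lift fR (quo_pi x) = f x.
Proof.
rewrite /quo_lift; have /asboolP Nx := qeq_repr x.
suff: [set z | f z = 1]%classic ((repr (quo_pi x))^-1 * x).
  by rewrite /= gmulfM gmulfV => /mulg1_eq; rewrite invgK.
apply: (smallest_sub _ _ Nx).
- split; first split=> /=.
  + exact: gmulf1.
  + by move=> a b a1 b1; rewrite gmulfM a1 b1 mulg1.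
  + by move=> a a1; rewrite gmulfV a1 invg1.
  + by move=> a g /= a1; rewrite gmulfJ a1 conj1g.
- by move=> _ [u [v [Ruv ->]]] /=; rewrite gmulfM gmulfV (fR Ruv) mulVg.
Qed.

Lemma quo_lift_morph : monoid_morphism (quo_lift fR).
Proof.
split; first by rewrite [LHS]quo_liftE gmulf1.
move=> x y; rewrite -[x]quo_reprK -[y]quo_reprK -quo_pi_morph.2.
by rewrite !quo_liftE gmulfM.
Qed.

HB.instance Definition _ :=
  isUMagmaMorphism.Build quotient_by K (quo_lift fR) quo_lift_morph.

End Lift.
End Quotient.

Arguments quo_pi : simpl never.
Arguments quo_lift : simpl never.

Section Presented.
Variables (X : choiceType) (R : free_group X -> free_group X -> Prop).

Definition presented := quotient_by R.
HB.instance Definition _ := Group.on presented.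

Definition pgen (x : X) : presented := quo_pi R (gen x).

End Presented.

Arguments pgen : simpl never.

(* The free product is presented by all elements of all factors, subject to the
   multiplication tables of the factors. *)
Section FreeProduct.
Variables (T : choiceType) (G : T -> groupType).

Variant free_product_rel : free_group {t & G t} -> free_group {t & G t} -> Prop :=
  FreeProductRel t (g h : G t) :
    free_product_rel (gen (Tagged G g) * gen (Tagged G h))
                     (gen (Tagged G (g * h))).

Definition free_product := presented free_product_rel.
HB.instance Definition _ := Group.on free_product.

Definition fp_in t (g : G t) : free_product :=
  pgen free_product_rel (Tagged G g).

End FreeProduct.

Local Open Scope fset_scope.

Notation small_subset I := {J : {fset I} | (#|` J| <= 2)%N}.

Record corson_diagram (I : choiceType) := CorsonDiagram {
  vgrp : small_subset I -> groupType;
  vmap : forall J1 J2 : small_subset I, val J1 `<` val J2 -> group_hom (vgrp J1) (vgrp J2);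
  vmap_inj : forall (J1 J2 : small_subset I) (s12 : val J1 `<` val J2),
    injective (vmap s12);
  vmap_comp : forall (J1 J2 J3 : small_subset I) (s12 : val J1 `<` val J2)
      (s23 : val J2 `<` val J3) (s13 : val J1 `<` val J3),
    val J1 = fset0 -> #|` val J3| = 2 ->
    vmap s13 =1 vmap s23 \o vmap s12
}.

Section Colimit.
Variables (I : choiceType) (D : corson_diagram I).

Variant colimit_rel : free_product (vgrp D) -> free_product (vgrp D) -> Prop :=
  ColimitRel (J1 J2 : small_subset I) (s12 : val J1 `<` val J2) (g : vgrp D J1) :
    colimit_rel (fp_in g) (fp_in (vmap D s12 g)).

Definition colimit_group := quotient_by colimit_rel.
HB.instance Definition _ := Group.on colimit_group.

Definition colimit_in (J : small_subset I) (g : vgrp D J) : colimit_group :=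
  quo_pi colimit_rel (fp_in g).

Definition restriction (K : set I) : set colimit_group :=
  generated [set x | exists (J : small_subset I) (g : vgrp D J),
    (forall i, i \in val J -> K i) /\ x = colimit_in g].

End Colimit.

(* I = {1, 2, 3} is represented by 'I_3 = {0, 1, 2}; i1, i2, i3 also index the
   generators a, b, c. *)
Definition i1 : 'I_3 := @Ordinal 3 0 isT.
Definition i2 : 'I_3 := @Ordinal 3 1 isT.
Definition i3 : 'I_3 := @Ordinal 3 2 isT.

(* G_J is presented by the generators with index in J and those of the relations
   b^-1 a b = a^2, c^-1 a c = a^2, b c = c b in which only these occur: for
   |J| <= 1 there are none (so G_J is trivial if J is empty, and free on one
   generator if |J| = 1), and for |J| = 2 there is exactly one. *)
Variant tri_rel (J : {fset 'I_3}) : free_group J -> free_group J -> Prop :=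
| TriRelAB (a b : J) of val a = i1 & val b = i2 :
    tri_rel ((gen b)^-1 * gen a * gen b) (gen a ^+ 2)
| TriRelAC (a c : J) of val a = i1 & val c = i3 :
    tri_rel ((gen c)^-1 * gen a * gen c) (gen a ^+ 2)
| TriRelBC (b c : J) of val b = i2 & val c = i3 :
    tri_rel (gen b * gen c) (gen c * gen b).

Definition tri_grp (J : small_subset 'I_3) : groupType := presented (@tri_rel (val J)).

Section TriMap.
Variables (J1 J2 : small_subset 'I_3) (s12 : val J1 `<` val J2).

Definition tri_gen (x : val J1) : tri_grp J2 :=
  pgen (@tri_rel (val J2)) (fincl (fproper_sub s12) x).

Lemma tri_gen_rel u v : tri_rel u v -> free_lift tri_gen u = free_lift tri_gen v.
Proof.
pose inc := fincl (fproper_sub s12).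
case=> [a b va vb|a c va vc|b c vb vc].
- have := quo_rel (TriRelAB (a := inc a) (b := inc b) va vb).
  by rewrite !(gmulfXn, gmulfM, gmulfV) /= !free_lift_gen.
- have := quo_rel (TriRelAC (a := inc a) (c := inc c) va vc).
  by rewrite !(gmulfXn, gmulfM, gmulfV) /= !free_lift_gen.
- have := quo_rel (TriRelBC (b := inc b) (c := inc c) vb vc).
  by rewrite !(gmulfXn, gmulfM, gmulfV) /= !free_lift_gen.
Qed.

Definition tri_map : group_hom (tri_grp J1) (tri_grp J2) := quo_lift tri_gen_rel.

Lemma tri_map_gen x : tri_map (pgen _ x) = tri_gen x.
Proof. exact: etrans (quo_liftE _ _) (free_lift_gen _ _). Qed.

End TriMap.

Arguments tri_map : simpl never.

Lemma pres_ind (X : choiceType) (R : free_group X -> free_group X -> Prop)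
    (P : presented R -> Prop) :
  P 1 -> (forall x g, P g -> P (pgen R x * g)) ->
  (forall x g, P g -> P ((pgen R x)^-1 * g)) -> forall g, P g.
Proof.
move=> P1 PM PV g; rewrite -[g]quo_reprK.
elim/free_ind: (repr g) => [|x h IHh|x h IHh].
- by rewrite gmulf1.
- by rewrite gmulfM; apply: PM.
- by rewrite gmulfM gmulfV; apply: PV.
Qed.

Lemma pres_hom_ext (X : choiceType) (R : free_group X -> free_group X -> Prop)
    (H : groupType) (f g : group_hom (presented R) H) :
  (forall x, f (pgen R x) = g (pgen R x)) -> f =1 g.
Proof.
move=> fg; elim/pres_ind => [|x h IHh|x h IHh]; first by rewrite !gmulf1.
- by rewrite !gmulfM fg IHh.
- by rewrite !gmulfM !gmulfV fg IHh.
Qed.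

Lemma tri_map_comp (J1 J2 J3 : small_subset 'I_3) (s12 : val J1 `<` val J2)
    (s23 : val J2 `<` val J3) (s13 : val J1 `<` val J3) :
  tri_map s13 =1 tri_map s23 \o tri_map s12.
Proof.
apply: pres_hom_ext => x; rewrite -[RHS]/(tri_map s23 (tri_map s12 _)) !tri_map_gen.
by congr pgen; apply: val_inj.
Qed.

(* Injectivity of the maps of the triangle: all its groups act compatibly on
   the rational line by affine maps, a by x + 1 and b, c by x / 2, and these
   maps have infinite order.  The pair (k, t) stands for x |-> 2^k x + t. *)
Definition affine : Type := (int * rat)%type.

Section Affine.
Local Open Scope ring_scope.
Import GRing.Theory Num.Theory.

HB.instance Definition _ := Choice.copy affine (int * rat)%type.

Definition aff_mul (x y : affine) : affine := (x.1 + y.1, x.2 + 2 ^ x.1 * y.2).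
Definition aff_inv (x : affine) : affine := (- x.1, - (2 ^ (- x.1) * x.2)).

Let two_neq0 : (2 : rat) != 0. Proof. by []. Qed.

Lemma aff_mulA : associative aff_mul.
Proof.
move=> [k x] [l y] [m z]; rewrite /aff_mul /= addrA expfzDr //.
by rewrite mulrDr !addrA mulrA.
Qed.

Lemma aff_mul1 : left_id ((0, 0) : affine) aff_mul.
Proof. by move=> [k x]; rewrite /aff_mul /= !add0r expr0z mul1r. Qed.

Lemma aff_1mul : right_id ((0, 0) : affine) aff_mul.
Proof. by move=> [k x]; rewrite /aff_mul /= mulr0 !addr0. Qed.

Lemma aff_mulV : left_inverse ((0, 0) : affine) aff_inv aff_mul.
Proof. by move=> [k x]; rewrite /aff_mul /= !addNr. Qed.

Lemma aff_Vmul : right_inverse ((0, 0) : affine) aff_inv aff_mul.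
Proof.
move=> [k x]; rewrite /aff_mul /= subrr mulrN mulrA -expfzDr // subrr.
by rewrite expr0z mul1r subrr.
Qed.

HB.instance Definition _ :=
  isGroup.Build affine aff_mulA aff_mul1 aff_1mul aff_mulV aff_Vmul.

Definition aff_a : affine := (0, 1).
Definition aff_bc : affine := (-1, 0).
Definition aff_gen (i : 'I_3) : affine := if i == i1 then aff_a else aff_bc.

Lemma aff_expn1 n : (aff_a ^+ n)%g = (0, n%:R) :> affine.
Proof.
elim: n => // n IHn; rewrite expgS IHn -[LHS]/(aff_mul _ _) /aff_mul /=.
by rewrite expr0z mul1r addr0 -nat1r.
Qed.

Lemma aff_expn2 n : (aff_bc ^+ n)%g = (- n%:Z, 0) :> affine.
Proof.
elim: n => // n IHn; rewrite expgS IHn -[LHS]/(aff_mul _ _) /aff_mul /=.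
by rewrite mulr0 addr0 -opprD -intS.
Qed.

Lemma aff_gen_order i n : (aff_gen i ^+ n)%g = 1%g -> n = 0.
Proof.
rewrite /aff_gen; case: ifP => _; rewrite ?aff_expn1 ?aff_expn2.
- by case=> /eqP; rewrite pnatr_eq0 => /eqP.
- by case=> /eqP; rewrite oppr_eq0 => /eqP [].
Qed.

Lemma aff_gen_rel (J : {fset 'I_3}) (u v : free_group J) :
  tri_rel u v ->
  free_lift (fun i : J => aff_gen (val i)) u =
  free_lift (fun i : J => aff_gen (val i)) v.
Proof.
case=> [a b va vb|a c va vc|b c vb vc];
  rewrite !(gmulfXn, gmulfM, gmulfV) /= !free_lift_gen ?va ?vb ?vc //.
Qed.

End Affine.

Definition tri_aff (J : small_subset 'I_3) : group_hom (tri_grp J) affine :=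
  quo_lift (@aff_gen_rel (val J)).

Arguments tri_aff : simpl never.

Lemma tri_aff_gen (J : small_subset 'I_3) x :
  tri_aff J (pgen _ x) = aff_gen (val x).
Proof. exact: etrans (quo_liftE _ _) (free_lift_gen _ _). Qed.

Lemma tri_aff_map (J1 J2 : small_subset 'I_3) (s12 : val J1 `<` val J2) :
  tri_aff J2 \o tri_map s12 =1 tri_aff J1.
Proof.
by apply: pres_hom_ext => x; rewrite -[LHS]/(tri_aff J2 (tri_map s12 _)) tri_map_gen !tri_aff_gen.
Qed.

Lemma tri_cyclic (J : small_subset 'I_3) (g : tri_grp J) : (#|` val J| <= 1)%N ->
  g = 1 \/ exists x n, g = pgen _ x ^+ n \/ g = pgen _ x ^- n.
Proof.
move=> J1; have eqJ (x y : val J) : x = y.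
  by apply: fintype_le1P; rewrite -cardfE.
elim/pres_ind: g => [|x g [->|[y [n IH]]]|x g [->|[y [n IH]]]]; first by left.
- by right; exists x, 1%N; left; rewrite mulg1.
- right; exists x; rewrite (eqJ y x) in IH; case: IH => ->.
    by exists n.+1; left; rewrite expgS.
  case: n => [|n]; first by exists 1%N; left; rewrite expg0 invg1 mulg1.
  by exists n; right; rewrite expgSr invgM mulVKg.
- by right; exists x, 1%N; right; rewrite mulg1.
- right; exists x; rewrite (eqJ y x) in IH; case: IH => ->.
    case: n => [|n]; first by exists 1%N; right; rewrite expg0 mulg1.
    by exists n; left; rewrite expgS mulKg.
  by exists n.+1; right; rewrite expgSr invgM.
Qed.

Lemma tri_map_inj (J1 J2 : small_subset 'I_3) (s12 : val J1 `<` val J2) :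
  injective (tri_map s12).
Proof.
apply: gmulf_inj => g g1.
have {g1} : tri_aff J1 g = 1 by rewrite -(tri_aff_map s12) /= g1 gmulf1.
have J1_le1 : (#|` val J1| <= 1)%N.
  by rewrite -ltnS; apply: leq_trans (fproper_ltn_card s12) (valP J2).
have [-> //|[x [n [->|->]]]] := tri_cyclic g J1_le1.
- by rewrite gmulfXn tri_aff_gen => /aff_gen_order ->.
- rewrite gmulfV gmulfXn tri_aff_gen => /eqP; rewrite invg_eq1 => /eqP.
  by move=> /aff_gen_order ->; rewrite expg0 invg1.
Qed.

Definition triangle : corson_diagram 'I_3 :=
  @CorsonDiagram 'I_3 tri_grp tri_map tri_map_inj
    (fun J1 J2 J3 s12 s23 s13 _ _ => tri_map_comp s12 s23 s13).

(* Main.v *)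
Require Import Defs.
From HB Require Import structures.
From mathcomp Require Import all_boot all_order all_algebra finmap all_classical.

(** The colimit group [G] is generated by [a], [b], [c] with [a^b = a^c = a^2]
    and [b c = c b].  Put [x := b a b^-1]; then [x^2 = a], so [x] is a square
    root of [a] in [G|_{1,2}].  It is the same square root as [c a c^-1],
    because [b] and [c] commute:
    [c^-1 x c = b (c^-1 a c) b^-1 = b a^2 b^-1 = a] ([half_conj_eq]).
    Hence [x] lies in [G|_{1,2}] and in [G|_{1,3}].

    It does not lie in [G|_{1} = <a>]: the affine representation, in which [a]
    is the translation by 1 and [b] and [c] are the homothety of ratio 1/2, is
    defined on every vertex group compatibly with the inclusions, hence on [G]
    by the universal property of the colimit ([colimit_lift]).  It maps [x] to
    the translation by 1/2, and every element of [<a>] to a translation by an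
    integer ([triangle_aff_restriction1]). *)

Set Implicit Arguments.
Unset Strict Implicit.
Unset Printing Implicit Defensive.

Local Open Scope group_scope.
Local Open Scope fset_scope.

(** * Universal properties of the free product and of the colimit *)

Section FreeProductLift.
Variables (T : choiceType) (G : T -> groupType) (H : groupType).
Variable f : forall t, group_hom (G t) H.

Let f_sum (x : {t & G t}) : H := f (tag x) (tagged x).

Lemma free_product_liftP u v : free_product_rel u v ->
  free_lift f_sum u = free_lift f_sum v.
Proof.
case=> t g h; rewrite gmulfM; transitivity (f t (g * h)).
  by rewrite gmulfM; congr (_ * _); apply: free_lift_gen.
by apply/esym; apply: free_lift_gen.
Qed.

Definition free_product_lift : group_hom (free_product G) H :=
  quo_lift free_product_liftP.

Lemma free_product_lift_in t (g : G t) : free_product_lift (fp_in g) = f t g.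
Proof. exact: etrans (quo_liftE _ _) (free_lift_gen _ _). Qed.

End FreeProductLift.

Section ColimitTheory.
Variables (I : choiceType) (D : corson_diagram I).

Lemma colimit_in_morph (J : small_subset I) :
  monoid_morphism (@colimit_in I D J).
Proof.
have inM (g h : vgrp D J) : colimit_in (g * h) = colimit_in g * colimit_in h.
  rewrite /colimit_in -gmulfM; congr quo_pi.
  have := quo_rel (FreeProductRel g h).
  by rewrite gmulfM => /esym.
split=> //.
have := inM 1 1; rewrite mulg1 => e.
apply: (@mulgI (colimit_group D) (colimit_in 1)).
exact: etrans (esym e) (esym (mulg1 _)).
Qed.

HB.instance Definition _ (J : small_subset I) :=
  isUMagmaMorphism.Build (vgrp D J) (colimit_group D) (@colimit_in I D J)
    (colimit_in_morph J).

(** [colimit_in] as a bundled morphism, so that morphism lemmas apply to it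
    after its source has been unfolded to a concrete group. *)
Definition colimit_hom (J : small_subset I) :
  group_hom (vgrp D J) (colimit_group D) := @colimit_in I D J.

Lemma colimit_in_vmap (J1 J2 : small_subset I) (s12 : val J1 `<` val J2)
    (g : vgrp D J1) :
  colimit_in (vmap D s12 g) = colimit_in g.
Proof. by apply/esym; apply: quo_rel; apply: ColimitRel. Qed.

Lemma restriction_in (K : set I) (J : small_subset I) (g : vgrp D J) :
  (forall i, i \in val J -> K i) -> restriction K (colimit_in g).
Proof. by move=> JK; apply: sub_gen_smallest; exists J, g. Qed.

Section Lift.
Variables (H : groupType) (f : forall J, group_hom (vgrp D J) H).
Hypothesis f_vmap : forall (J1 J2 : small_subset I) (s12 : val J1 `<` val J2) g,
  f J2 (vmap D s12 g) = f J1 g.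

Let f_product : group_hom (free_product (vgrp D)) H := free_product_lift f.

Let f_product_in J (g : vgrp D J) : f_product (fp_in g) = f J g.
Proof. exact: free_product_lift_in. Qed.

Lemma colimit_liftP u v : colimit_rel u v -> f_product u = f_product v.
Proof. by case=> J1 J2 s12 g; rewrite !f_product_in f_vmap. Qed.

Definition colimit_lift : group_hom (colimit_group D) H :=
  quo_lift colimit_liftP.

Lemma colimit_lift_in J (g : vgrp D J) : colimit_lift (colimit_in g) = f J g.
Proof. exact: etrans (quo_liftE _ _) (f_product_in _). Qed.

End Lift.
End ColimitTheory.

(** * Generators and relations of the colimit of the triangle *)

Lemma card_fset1_le2 (i : 'I_3) : (#|` [fset i]| <= 2)%N.
Proof. by rewrite cardfs1. Qed.

Lemma card_fset2_le2 (i j : 'I_3) : (#|` [fset i; j]| <= 2)%N.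
Proof. by rewrite cardfs2; case: (_ != _). Qed.

Definition point (i : 'I_3) : small_subset 'I_3 := Sub [fset i] (card_fset1_le2 i).
Definition edge (i j : 'I_3) : small_subset 'I_3 :=
  Sub [fset i; j] (card_fset2_le2 i j).

(** The image of [a], [b] or [c] in the colimit, for [i] = [i1], [i2], [i3]. *)
Definition triangle_gen (i : 'I_3) : colimit_group triangle :=
  @colimit_in _ triangle (point i) (pgen _ [` fset11 i]).

(** The maps of a diagram go along strict inclusions only, so the case
    [val J = {i}] is not an instance of [colimit_in_vmap] and is separate. *)
Lemma colimit_in_pgen (J : small_subset 'I_3) (i : 'I_3) (x : val J) :
  val x = i -> @colimit_in _ triangle J (pgen _ x) = triangle_gen i.
Proof.
move=> xi.
have sJ : val (point i) `<=` val J by rewrite fsub1set -xi; apply: valP.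
have [eqJ|neqJ] := eqVneq (val (point i)) (val J).
  have {}eqJ : point i = J by apply: val_inj.
  rewrite /triangle_gen; case: J / eqJ x xi sJ => x xi _.
  by congr (@colimit_in _ triangle _ (pgen _ _)); apply: val_inj.
have s1J : val (point i) `<` val J by rewrite fproperEneq neqJ.
rewrite /triangle_gen.
rewrite -(@colimit_in_vmap _ triangle (point i) J s1J).
rewrite [vmap _ _ _]tri_map_gen.
by congr (@colimit_in _ triangle _ (pgen _ _)); apply: val_inj.
Qed.

Definition edge_l (i j : 'I_3) : val (edge i j) := [` fset21 i j].
Definition edge_r (i j : 'I_3) : val (edge i j) := [` fset22 i j].

Definition edge_in (i j : 'I_3) :
    group_hom (tri_grp (edge i j)) (colimit_group triangle) :=
  colimit_hom triangle (edge i j).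

Lemma edge_in_l i j : edge_in i j (pgen _ (edge_l i j)) = triangle_gen i.
Proof. exact: colimit_in_pgen. Qed.

Lemma edge_in_r i j : edge_in i j (pgen _ (edge_r i j)) = triangle_gen j.
Proof. exact: colimit_in_pgen. Qed.

Local Notation a := (triangle_gen i1).
Local Notation b := (triangle_gen i2).
Local Notation c := (triangle_gen i3).

Lemma triangle_relAB : b^-1 * a * b = a ^+ 2.
Proof.
have := congr1 (edge_in i1 i2)
  (quo_rel (TriRelAB (a := edge_l i1 i2) (b := edge_r i1 i2) erefl erefl)).
by rewrite !(gmulfXn, gmulfM, gmulfV) /= edge_in_l edge_in_r.
Qed.

Lemma triangle_relAC : c^-1 * a * c = a ^+ 2.
Proof.
have := congr1 (edge_in i1 i3)
  (quo_rel (TriRelAC (a := edge_l i1 i3) (c := edge_r i1 i3) erefl erefl)).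
by rewrite !(gmulfXn, gmulfM, gmulfV) /= edge_in_l edge_in_r.
Qed.

Lemma triangle_relBC : b * c = c * b.
Proof.
have := congr1 (edge_in i2 i3)
  (quo_rel (TriRelBC (b := edge_l i2 i3) (c := edge_r i2 i3) erefl erefl)).
by rewrite !gmulfM /= edge_in_l edge_in_r.
Qed.

(** Both sides equal [(b c) a^2 (b c)^-1]: on the left [a] is replaced by
    [c a^2 c^-1], on the right by [b a^2 b^-1]. *)
Lemma half_conj_eq : b * a * b^-1 = c * a * c^-1.
Proof.
have aB : a = b * a ^+ 2 * b^-1.
  by rewrite -triangle_relAB -!mulgA mulVKg mulgV mulg1.
have aC : a = c * a ^+ 2 * c^-1.
  by rewrite -triangle_relAC -!mulgA mulVKg mulgV mulg1.
rewrite {1}aC {2}aB !mulgA triangle_relBC -!mulgA -!invgM.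
by rewrite triangle_relBC.
Qed.

Lemma half_in_restriction (i : 'I_3) :
  restriction (D := triangle) [set i1; i]%classic
    (triangle_gen i * a * (triangle_gen i)^-1).
Proof.
have <- : edge_in i1 i (pgen _ (edge_r i1 i) * pgen _ (edge_l i1 i) *
    (pgen _ (edge_r i1 i))^-1) = triangle_gen i * a * (triangle_gen i)^-1.
  by rewrite !gmulfM gmulfV /= edge_in_l edge_in_r.
apply: (@restriction_in _ triangle) => k.
by rewrite !inE => /orP[/eqP ->|/eqP ->]; [left | right].
Qed.

(** * The affine representation of the colimit *)

Definition triangle_aff : group_hom (colimit_group triangle) affine :=
  colimit_lift (D := triangle) (f := tri_aff) tri_aff_map.

Lemma triangle_aff_in (J : small_subset 'I_3) (g : tri_grp J) :
  triangle_aff (@colimit_in _ triangle J g) = tri_aff J g.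
Proof. by rewrite /triangle_aff colimit_lift_in. Qed.

Lemma triangle_aff_gen (i : 'I_3) : triangle_aff (triangle_gen i) = aff_gen i.
Proof. exact: etrans (triangle_aff_in _) (tri_aff_gen _). Qed.

Section IntTranslation.
Import GRing.Theory Num.Theory.
Local Open Scope ring_scope.

Lemma intr_neq_half (n : int) : n%:~R != 2^-1 :> rat.
Proof.
apply/eqP => n_half.
have : (n * 2)%:~R = 1%:~R :> rat by rewrite intrM n_half mulVf.
by move/intr_inj => /(congr1 (fun m => 2 %| m)%Z); rewrite dvdz_mull.
Qed.

Definition int_translation : set affine :=
  [set x | exists n : int, x = (0, n%:~R)]%classic.

Lemma int_translation_subgroup : subgroup int_translation.
Proof.
split.
- by exists 0.
- move=> _ _ [m ->] [n ->]; exists (m + n).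
  by rewrite -[LHS]/(aff_mul _ _) /aff_mul /= expr0z mul1r addr0 intrD.
- move=> _ [n ->]; exists (- n).
  by rewrite -[LHS]/(aff_inv _) /aff_inv /= oppr0 expr0z mul1r mulrNz.
Qed.

End IntTranslation.

(** A vertex group [G_J] with [J] contained in [{1}] is generated by at most
    [a], which acts as the translation by 1, and translations by integers form
    a subgroup. *)
Lemma triangle_aff_restriction1 (x : colimit_group triangle) :
  restriction [set i1]%classic x -> int_translation (triangle_aff x).
Proof.
have [T1 TM TV] := int_translation_subgroup.
suff: (restriction [set i1] `<=` triangle_aff @^-1` int_translation)%classic.
  exact.
apply: smallest_sub.
  split=> /=; first by rewrite gmulf1.
  - by move=> u v Tu Tv; rewrite gmulfM; apply: TM.
  - by move=> u Tu; rewrite gmulfV; apply: TV.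
move=> _ [J [g [J1 ->]]].
suff: int_translation (tri_aff J g) by rewrite -triangle_aff_in.
have Tgen (y : val J) : int_translation (tri_aff J (pgen _ y)).
  have y1 : val y = i1 := J1 _ (valP y).
  by rewrite tri_aff_gen y1; exists 1%R.
elim/pres_ind: g => [|y g IHg|y g IHg]; first by rewrite gmulf1.
- by rewrite gmulfM; apply: TM; [apply: Tgen | apply: IHg].
- rewrite gmulfM gmulfV; apply: TM; last by apply: IHg.
  by apply: TV; apply: Tgen.
Qed.

(** Conjugating by the homothety [b] of ratio 1/2 halves the translation [a]. *)
Lemma triangle_aff_half : triangle_aff (b * a * b^-1) = (0, 2^-1)%R.
Proof.
rewrite !gmulfM gmulfV !triangle_aff_gen.
by apply/eqP; vm_compute.
Qed.

Theorem proposition3p2 :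
  ~ (restriction (D := triangle) [set i1; i2] `&` restriction (D := triangle) [set i1; i3]
     = restriction (D := triangle) [set i1])%classic.
Proof.
move=> eqR.
have /triangle_aff_restriction1[n] :
    restriction (D := triangle) [set i1]%classic (b * a * b^-1).
  rewrite -eqR; split; first exact: half_in_restriction.
  by rewrite half_conj_eq; apply: half_in_restriction.
by rewrite triangle_aff_half => -[/esym/eqP]; rewrite (negPf (intr_neq_half n)).
Qed.
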